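(* Let $m$ be a nonnegative integer. Then $$(-1)^{m+1}\frac{\pi^{2m+2}}{4(2m+1)!}+\sum_{k=0}^m(-1)^k(1+\delta_k)\frac{\pi^{2k}}{(2k)!}\,\lambda(2m-2k+2)=0,$$ where $\delta_k=0$ if $k\neq0$ and $\delta_k=1$ if $k=0$.
   Context: The Dirichlet lambda function is $\lambda(s)=\sum_{n=0}^\infty\frac{1}{(2n+1)^s}$ for $\mathrm{Re}(s)>1$. *)

(* Defs.v *)
From Stdlib Require Import Reals.
From Coquelicot Require Import Coquelicot.

Local Open Scope R_scope.

Definition Cexp (z : C) : C :=
  (exp (Re z) * cos (Im z), exp (Re z) * sin (Im z)).

(* The principal power x^s = e^(s ln x); meaningful only for x > 0. *)
Definition Rpow_C (x : R) (s : C) : C := Cexp (s * RtoC (ln x))%C.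

(* Coquelicot has no total summation operator on C, so the series is summed
   componentwise.  The value is meaningful only for Re s > 1, where the series
   converges (absolutely). *)
Definition CSeries (a : nat -> C) : C :=
  (Series (fun n => Re (a n)), Series (fun n => Im (a n))).

Definition dirichlet_lambda (s : C) : C :=
  CSeries (fun n => (1 / Rpow_C (INR (2 * n + 1)) s)%C).

Definition delta (k : nat) : R := if Nat.eqb k 0 then 1 else 0.

(* Main.v *)
Require Import Defs.
From Stdlib Require Import Reals Factorial Lra Lia.
From Coquelicot Require Import Coquelicot.
Local Open Scope R_scope.

(** The relation comes from integrating even monomials against the Fourier
    series of a constant on (0, PI),

      sum_n sin (N t) / N = PI / 4,   where N = 2 n + 1.

    Two integrations by parts give, for
    J_m(N) = int_0^PI t^(2m) / (2m)! * sin (N t) / N dt, the recurrence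

      J_0(N) = 2 / N^2,
      J_(m+1)(N) = (PI^(2m+2) / (2m+2)! - J_m(N)) / N^2,

    so that (-1)^m J_m(N) = sum_(k <= m) (-1)^k (1 + delta_k) PI^(2k) / (2k)!
    / N^(2m-2k+2) ([is_RInt_monomial_sin]).  The factor 2 at k = 0 is the 2 of
    J_0: the cosine at both ends of the interval contributes.  Summing over n
    turns the right-hand side into the combination of lambda values in the
    theorem, and the left-hand side into
    (-1)^m int_0^PI t^(2m) / (2m)! * PI / 4 dt
    = (-1)^m PI^(2m+2) / (4 (2m+1)!).

    Exchanging the sum and the integral takes only convergence of the Fourier
    series in mean square, by Cauchy-Schwarz.  Orthogonality of the sines shows
    that the squared distance of the n-th partial sum to PI / 4 is
    PI / 2 * (PI^2 / 8 - sum_(k <= n) 1 / (2k+1)^2)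
    ([is_RInt_square_wave_error]), so everything rests on the single value
    lambda(2) = PI^2 / 8 ([is_series_inv_odd_sq]).

    That value is obtained from the finite identity
    sum_(k < M) 1 / sin^2 ((2k+1) PI / (4M)) = 2 M^2 for M = 2^p, proved by
    halving angles, together with 1 / x^2 <= 1 / sin^2 x <= 1 + 1 / x^2 on
    (0, PI / 2). *)

(** * Integrals and limits *)

(** The canonical structures leave equations between reals typed in the carrier
   of an algebraic structure on R, which the arithmetic tactics do not see. *)
Ltac eqR := match goal with |- @eq _ ?x ?y => change (@eq R x y) end.

Lemma is_RInt_antiderivative (F f : R -> R) (a b : R) :
  (forall t, is_derive F t (f t)) -> (forall t, ex_derive f t) ->
  is_RInt f a b (F b - F a).
Proof.
intros dF cf.
apply (is_RInt_derive F f); intros t _; [apply dF | ].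
apply (ex_derive_continuous (V := R_NormedModule)), cf.
Qed.

Lemma is_RInt_lincomb (f g : R -> R) (a b x y If Ig : R) :
  is_RInt f a b If -> is_RInt g a b Ig ->
  is_RInt (fun t => x * f t + y * g t) a b (x * If + y * Ig).
Proof.
intros Hf Hg.
exact (is_RInt_plus _ _ _ _ _ _ (is_RInt_scal _ _ _ x _ Hf)
                                (is_RInt_scal _ _ _ y _ Hg)).
Qed.

Lemma is_RInt_Rmult_l (f : R -> R) (a b x If : R) :
  is_RInt f a b If -> is_RInt (fun t => x * f t) a b (x * If).
Proof. exact (is_RInt_scal f a b x If). Qed.

(** Lets an integral be computed in whatever shape the rules produce, leaving
    the integrand and the value to the arithmetic tactics. *)
Lemma is_RInt_congr (f g : R -> R) (a b If Ig : R) :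
  is_RInt f a b If -> (forall t, f t = g t) -> If = Ig -> is_RInt g a b Ig.
Proof.
intros Hf fg <-. apply (is_RInt_ext f); auto.
Qed.

(** The quadratic polynomial x |-> int (x f + g)^2 is nonnegative; its value at
    the minimum -D/A gives the bound. *)
Lemma Cauchy_Schwarz_RInt (f g : R -> R) (a b A B D : R) : a <= b ->
  is_RInt (fun t => f t ^ 2) a b A -> is_RInt (fun t => g t ^ 2) a b B ->
  is_RInt (fun t => f t * g t) a b D -> D ^ 2 <= A * B.
Proof.
intros ab HA HB HD.
assert (quad : forall x, 0 <= x ^ 2 * A + 2 * x * D + B).
{ intro x.
  apply (is_RInt_ge_0 (fun t => (x * f t + g t) ^ 2) a b); trivial.
  - eapply is_RInt_congr.
    + exact (is_RInt_lincomb _ _ _ _ 1 1 _ _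
        (is_RInt_lincomb _ _ _ _ (x ^ 2) (2 * x) _ _ HA HD) HB).
    + intro t; simpl; ring.
    + ring.
  - intros t _. apply pow2_ge_0. }
assert (A0 : 0 <= A).
{ apply (is_RInt_ge_0 (fun t => f t ^ 2) a b); trivial.
  intros t _. apply pow2_ge_0. }
destruct (Req_dec A 0) as [-> | An0].
- destruct (Req_dec D 0) as [-> | Dn0]; [lra | ].
  (* The polynomial is affine and not constant: here it takes the value -1. *)
  specialize (quad (- (B + 1) / (2 * D))).
  replace (_ + B) with (-1) in quad by (field; trivial).
  lra.
- specialize (quad (- D / A)).
  replace (_ + B) with ((A * B - D ^ 2) / A) in quad by (field; trivial).
  apply Rmult_le_compat_r with (r := A) in quad; trivial.
  replace ((A * B - D ^ 2) / A * A) with (A * B - D ^ 2) in quad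
    by (field; trivial).
  lra.
Qed.

Lemma is_lim_seq_of_sq_dist (u : nat -> R) (l : R) :
  is_lim_seq (fun n => (l - u n) ^ 2) 0 -> is_lim_seq u l.
Proof.
intro H.
assert (H0 : is_lim_seq (fun n => l - u n) 0).
{ apply is_lim_seq_abs_0.
  apply is_lim_seq_ext with (fun n => sqrt ((l - u n) ^ 2)).
  { intro n. rewrite <- Rsqr_pow2. apply sqrt_Rsqr_abs. }
  rewrite <- sqrt_0.
  apply is_lim_seq_continuous; trivial.
  apply continuity_pt_sqrt; lra. }
apply is_lim_seq_ext with (fun n => l - (l - u n)).
{ intro n; ring. }
replace (Finite l) with (Finite (l - 0)) by (f_equal; ring).
apply is_lim_seq_minus'; trivial.
apply is_lim_seq_const.
Qed.

Lemma sign_mul_sign (m : nat) : (-1) ^ m * (-1) ^ m = 1.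
Proof.
rewrite <- Rpow_mult_distr.
replace (-1 * -1) with 1 by ring. apply pow1.
Qed.

Lemma sum_n_Rmult_l (c : R) (a : nat -> R) (n : nat) :
  sum_n (fun k => c * a k) n = c * sum_n a n.
Proof. exact (sum_n_mult_l (K := R_Ring) c a n). Qed.

Lemma is_series_sum_n (a : nat -> nat -> R) (l : nat -> R) (m : nat) :
  (forall k, (k <= m)%nat -> is_series (a k) (l k)) ->
  is_series (fun n => sum_n (fun k => a k n) m) (sum_n l m).
Proof.
induction m as [ | m IH]; intro H.
- rewrite sum_O.
  apply is_series_ext with (a 0%nat); [intro n; now rewrite sum_O | ].
  apply H; lia.
- rewrite sum_Sn.
  apply is_series_ext with
    (fun n => plus (sum_n (fun k => a k n) m) (a (S m) n)).
  { intro n; now rewrite sum_Sn. }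
  apply (is_series_plus (V := R_NormedModule)).
  + apply IH; intros; apply H; lia.
  + apply H; lia.
Qed.

(** * Odd numbers *)

Definition odd (n : nat) : R := INR (2 * n + 1).

Lemma oddE n : odd n = 2 * INR n + 1.
Proof. unfold odd. rewrite plus_INR, mult_INR. simpl; ring. Qed.

Lemma odd_pos n : 0 < odd n.
Proof. rewrite oddE. generalize (pos_INR n); lra. Qed.

Lemma odd_neq0 n : odd n <> 0.
Proof. generalize (odd_pos n); lra. Qed.

Lemma sin_odd_PI n : sin (odd n * PI) = 0.
Proof.
apply sin_eq_0_1. exists (2 * Z.of_nat n + 1)%Z.
now rewrite oddE, plus_IZR, mult_IZR, <- INR_IZR_INZ.
Qed.

Lemma cos_odd_PI n : cos (odd n * PI) = -1.
Proof.
rewrite oddE.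
replace ((2 * INR n + 1) * PI) with (PI + 2 * INR n * PI) by ring.
rewrite cos_period. apply cos_PI.
Qed.

Lemma sin_odd_add_PI i j : sin ((odd i + odd j) * PI) = 0.
Proof.
rewrite Rmult_plus_distr_r, sin_plus, !sin_odd_PI; ring.
Qed.

Lemma sin_odd_sub_PI i j : sin ((odd i - odd j) * PI) = 0.
Proof.
unfold Rminus. rewrite Rmult_plus_distr_r, <- Ropp_mult_distr_l, sin_plus.
rewrite sin_neg, !sin_odd_PI; ring.
Qed.

Lemma odd_inj_sub i j : i <> j -> odd i - odd j <> 0.
Proof.
intros ij H. apply ij. apply INR_eq. rewrite !oddE in H. lra.
Qed.

(** * The sum of the inverse squares of the odd numbers *)

(** By induction on n for all f: the step splits off the first and the last
    term, which shifts f by one. *)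
Lemma sum_n_fold_half (f : nat -> R) (n : nat) :
  sum_n f (2 * n + 1) = sum_n (fun k => f k + f (2 * n + 1 - k)%nat) n.
Proof.
revert f. induction n as [ | n IH]; intro f.
- simpl. now rewrite sum_Sn, !sum_O.
- replace (2 * S n + 1)%nat with (S (S (2 * n + 1))) by lia.
  rewrite sum_Sn. unfold sum_n at 1.
  rewrite sum_Sn_m, <- sum_n_m_S by lia.
  fold (sum_n (fun k => f (S k)) (2 * n + 1)). rewrite IH.
  unfold sum_n at 2. rewrite sum_Sn_m, <- sum_n_m_S by lia.
  fold (sum_n (fun k => f (S k) + f (S (S (2 * n + 1)) - S k)%nat) n).
  rewrite Nat.sub_0_r.
  rewrite (sum_n_ext_loc (fun k => f (S k) + f (S (S (2 * n + 1)) - S k)%nat)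
     (fun k => f (S k) + f (S (2 * n + 1 - k)))).
  + unfold plus; simpl. eqR; ring.
  + intros k kn. do 2 f_equal. lia.
Qed.

(** The angle (2k+1) PI / (4M) with M = n + 1, the number of terms of a sum
    [sum_n _ n]. *)
Definition angle (n k : nat) : R := odd k * PI / (4 * INR (S n)).

Lemma angle_bounds n k : (k <= n)%nat -> 0 < angle n k < PI / 2.
Proof.
intro kn. unfold angle.
assert (0 < INR (S n)) by (apply lt_0_INR; lia).
assert (P := PI_RGT_0). assert (O := odd_pos k).
split.
- apply Rdiv_lt_0_compat; [apply Rmult_lt_0_compat | ]; lra.
- apply Rmult_lt_reg_r with (4 * INR (S n)); [lra | ].
  replace (_ / (4 * INR (S n)) * _) with (odd k * PI) by (field; lra).
  replace (PI / 2 * _) with (2 * INR (S n) * PI) by field.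
  apply Rmult_lt_compat_r; trivial.
  rewrite oddE, S_INR. apply le_INR in kn. lra.
Qed.

(** Since 1 / sin^2 + 1 / cos^2 = 1 / (sin cos)^2 = 4 / sin^2 of the double
    angle; the cosine is written as a sine so that both terms have the same
    form. *)
Lemma inv_sin_sq_half x : sin (x / 2) <> 0 -> cos (x / 2) <> 0 ->
  / sin (x / 2) ^ 2 + / sin (PI / 2 - x / 2) ^ 2 = 4 * / sin x ^ 2.
Proof.
intros s0 c0. rewrite sin_shift.
replace (sin x) with (2 * sin (x / 2) * cos (x / 2))
  by (rewrite <- sin_2a; f_equal; field).
apply (Rmult_eq_reg_l (sin (x / 2) ^ 2 * cos (x / 2) ^ 2)).
2: apply Rmult_integral_contrapositive; split; apply pow_nonzero; trivial.
transitivity (sin (x / 2) ^ 2 + cos (x / 2) ^ 2); [field; auto | ].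
rewrite <- !Rsqr_pow2, sin2_cos2. unfold Rsqr. field; auto.
Qed.

(** Halving the angles of the sum with M terms gives the first half of the
    angles of the sum with 2M terms; their complements to PI / 2 give the other
    half. *)
Lemma sum_inv_sin_sq_double n :
  sum_n (fun k => / sin (angle (2 * n + 1) k) ^ 2) (2 * n + 1)
  = 4 * sum_n (fun k => / sin (angle n k) ^ 2) n.
Proof.
rewrite sum_n_fold_half.
rewrite <- sum_n_Rmult_l.
apply sum_n_ext_loc. intros k kn.
assert (n0 : 0 < INR (S n)) by (apply lt_0_INR; lia).
assert (E : INR (S (2 * n + 1)) = 2 * INR (S n)).
{ replace (S (2 * n + 1)) with (2 * S n)%nat by lia. now rewrite mult_INR. }
destruct (angle_bounds n k kn) as [a0 a1].
replace (angle (2 * n + 1) k) with (angle n k / 2).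
2: unfold angle; rewrite E; field; lra.
replace (angle (2 * n + 1) (2 * n + 1 - k)) with (PI / 2 - angle n k / 2).
2: { unfold angle. rewrite E, !oddE, minus_INR, S_INR by lia.
     rewrite S_INR in n0.
     rewrite plus_INR, mult_INR; simpl. field; lra. }
apply inv_sin_sq_half.
- apply Rgt_not_eq, sin_gt_0; lra.
- apply Rgt_not_eq, cos_gt_0; lra.
Qed.

Lemma sum_inv_sin_sq p :
  sum_n (fun k => / sin (angle (2 ^ p - 1) k) ^ 2) (2 ^ p - 1)
  = 2 * INR (2 ^ p) ^ 2.
Proof.
induction p as [ | p IH].
- change (2 ^ 0 - 1)%nat with 0%nat. rewrite sum_O.
  replace (angle 0 0) with (PI / 4) by (unfold angle, odd; simpl; field).
  assert (Q : sin (PI / 4) ^ 2 = / 2).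
  { generalize (sin2_cos2 (PI / 4)). rewrite <- sin_cos_PI4.
    unfold Rsqr. lra. }
  rewrite Q. simpl. field.
- assert (0 < 2 ^ p)%nat by (apply Nat.neq_0_lt_0, Nat.pow_nonzero; lia).
  replace (2 ^ S p - 1)%nat with (2 * (2 ^ p - 1) + 1)%nat by (simpl; lia).
  rewrite sum_inv_sin_sq_double, IH.
  replace (2 ^ S p)%nat with (2 * 2 ^ p)%nat by (simpl; lia).
  rewrite mult_INR. simpl; ring.
Qed.

(** The function sin x - x cos x vanishes at 0 and has derivative x sin x. *)
Lemma mul_cos_le_sin x : 0 <= x <= PI -> x * cos x <= sin x.
Proof.
intro Hx.
assert (I : 0 <= (sin x - x * cos x) - (sin 0 - 0 * cos 0)).
{ apply (is_RInt_ge_0 (fun t => t * sin t) 0 x); [lra | | ].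
  - apply (is_RInt_antiderivative (fun t => sin t - t * cos t)).
    + intro t. auto_derive; trivial. ring.
    + intro t. auto_derive; trivial.
  - intros t Ht. apply Rmult_le_pos; [lra | ].
    apply sin_ge_0; lra. }
rewrite sin_0 in I. lra.
Qed.

(** From sin x <= x <= tan x, as 1 / sin^2 x = 1 + 1 / tan^2 x. *)
Lemma inv_sin_sq_bounds x : 0 < x < PI / 2 ->
  / x ^ 2 <= / sin x ^ 2 <= 1 + / x ^ 2.
Proof.
intro Hx.
assert (s0 : 0 < sin x) by (apply sin_gt_0; lra).
assert (sx := sin_lt_x x ltac:(lra)).
assert (c0 : 0 < cos x) by (apply cos_gt_0; lra).
assert (sc := mul_cos_le_sin x ltac:(lra)).
split.
- apply Rinv_le_contravar; [apply pow_lt; lra | ].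
  apply pow_incr; lra.
- assert (E : (x * cos x) ^ 2 <= sin x ^ 2).
  { apply pow_incr. split; trivial. apply Rmult_le_pos; lra. }
  apply Rmult_le_reg_r with (x ^ 2 * sin x ^ 2).
  { apply Rmult_lt_0_compat; apply pow_lt; lra. }
  replace (/ sin x ^ 2 * _) with (x ^ 2) by (field; lra).
  replace ((1 + / x ^ 2) * _) with (x ^ 2 * sin x ^ 2 + sin x ^ 2)
    by (field; lra).
  assert (T := sin2_cos2 x). rewrite !Rsqr_pow2 in T.
  rewrite Rpow_mult_distr in E.
  replace (cos x ^ 2) with (1 - sin x ^ 2) in E by lra.
  lra.
Qed.

Lemma sum_n_le_loc (a b : nat -> R) n :
  (forall k, (k <= n)%nat -> a k <= b k) -> sum_n a n <= sum_n b n.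
Proof.
induction n as [ | n IH]; intro H.
- rewrite !sum_O. now apply H.
- rewrite !sum_Sn. apply Rplus_le_compat; [apply IH; intros | ]; apply H; lia.
Qed.

(** With M = 2^p, multiply the inequalities of [inv_sin_sq_bounds] at the
    angles (2k+1) PI / (4M) by c = PI^2 / (16 M^2) and sum: the middle becomes
    c * 2 M^2 = PI^2 / 8, and the error is at most M c. *)
Lemma sum_inv_odd_sq_bounds p :
  PI ^ 2 / 8 - PI ^ 2 / 16 * / INR (2 ^ p)
  <= sum_n (fun k => / odd k ^ 2) (2 ^ p - 1) <= PI ^ 2 / 8.
Proof.
set (n := (2 ^ p - 1)%nat).
assert (Sn : S n = (2 ^ p)%nat).
{ assert (0 < 2 ^ p)%nat by (apply Nat.neq_0_lt_0, Nat.pow_nonzero; lia).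
  unfold n; lia. }
assert (n0 : 0 < INR (S n)) by (apply lt_0_INR; lia).
assert (P := PI_RGT_0).
assert (T := sum_inv_sin_sq p). fold n in T. rewrite <- Sn in *.
set (c := PI ^ 2 / (16 * INR (S n) ^ 2)).
assert (c0 : 0 < c).
{ apply Rdiv_lt_0_compat; [apply pow_lt; lra | ].
  assert (0 < INR (S n) ^ 2) by (apply pow_lt; lra). lra. }
assert (E : forall k, / odd k ^ 2 = c * / angle n k ^ 2).
{ intro k. unfold c, angle. assert (O := odd_pos k). field. lra. }
assert (U : sum_n (fun k => c * / sin (angle n k) ^ 2) n = PI ^ 2 / 8 :> R).
{ rewrite sum_n_Rmult_l, T. unfold c. field. lra. }
rewrite <- U. split.
- apply Rle_trans with (sum_n (fun k => c * / sin (angle n k) ^ 2 - c) n).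
  + right.
    replace (PI ^ 2 / 16 * / INR (S n)) with (sum_n (fun _ => c) n).
    2: { rewrite sum_n_const. eqR. unfold c. field. lra. }
    assert (X : sum_n (fun k => c * / sin (angle n k) ^ 2 - c) n
       + sum_n (fun _ => c) n = sum_n (fun k => c * / sin (angle n k) ^ 2) n).
    { etransitivity; [symmetry; apply (sum_n_plus (G := R_AbelianMonoid)) | ].
      apply sum_n_ext. intro k. unfold plus; simpl. eqR; ring. }
    rewrite <- X. ring.
  + apply sum_n_le_loc. intros k kn. rewrite E.
    destruct (inv_sin_sq_bounds _ (angle_bounds n k kn)) as [_ B].
    apply (Rmult_le_compat_l c) in B; lra.
- apply sum_n_le_loc. intros k kn. rewrite E.
  apply Rmult_le_compat_l; [lra | ].
  apply (inv_sin_sq_bounds _ (angle_bounds n k kn)).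
Qed.

(** The partial sums increase, so their limit is that of the subsequence
    controlled by [sum_inv_odd_sq_bounds]. *)
Lemma is_series_inv_odd_sq : is_series (fun k => / odd k ^ 2) (PI ^ 2 / 8).
Proof.
set (s := sum_n (fun k => / odd k ^ 2)).
assert (incr : forall i j, (i <= j)%nat -> s i <= s j).
{ intros i j ij. induction ij as [ | j ij IH]; [lra | ].
  apply Rle_trans with (s j); trivial. unfold s. rewrite sum_Sn.
  assert (0 < / odd (S j) ^ 2)
    by (apply Rinv_0_lt_compat, pow_lt, odd_pos).
  unfold plus; simpl. simpl in H. lra. }
assert (big : forall p, (p < 2 ^ p)%nat).
{ intro p. apply Nat.pow_gt_lin_r; lia. }
assert (ub : forall n, s n <= PI ^ 2 / 8).
{ intro n. apply Rle_trans with (s (2 ^ n - 1)%nat).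
  - apply incr. generalize (big n); lia.
  - apply sum_inv_odd_sq_bounds. }
assert (lim : ex_finite_lim_seq s).
{ apply ex_finite_lim_seq_incr with (PI ^ 2 / 8); trivial.
  intro n; apply incr; lia. }
destruct lim as [l Hl].
assert (sub : forall phi : nat -> nat, (forall n, (n <= phi n)%nat) ->
   filterlim phi eventually eventually).
{ intros phi H P [N HN]. exists N. intros n Nn. apply HN.
  generalize (H n); lia. }
assert (H1 : is_lim_seq (fun p => s (2 ^ p - 1)%nat) l).
{ apply (is_lim_seq_subseq s l (fun p => 2 ^ p - 1)%nat); trivial.
  apply sub. intro p. generalize (big p); lia. }
assert (H2 : is_lim_seq (fun p => s (2 ^ p - 1)%nat) (PI ^ 2 / 8)).
{ apply is_lim_seq_le_le with
    (fun p => PI ^ 2 / 8 - PI ^ 2 / 16 * / INR (2 ^ p))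
    (fun _ => PI ^ 2 / 8).
  - exact sum_inv_odd_sq_bounds.
  - replace (Finite (PI ^ 2 / 8))
      with (Finite (PI ^ 2 / 8 - PI ^ 2 / 16 * 0)) by (f_equal; ring).
    apply is_lim_seq_minus'; [apply is_lim_seq_const | ].
    apply is_lim_seq_mult'; [apply is_lim_seq_const | ].
    replace (Finite 0) with (Rbar_inv p_infty) by trivial.
    apply is_lim_seq_inv; [ | easy].
    apply (is_lim_seq_subseq INR p_infty (fun p => 2 ^ p)%nat).
    + apply sub. intro p. generalize (big p); lia.
    + apply is_lim_seq_INR.
  - apply is_lim_seq_const. }
assert (X := is_lim_seq_unique _ _ H1).
rewrite (is_lim_seq_unique _ _ H2) in X. apply (f_equal real) in X.
unfold is_series. replace (PI ^ 2 / 8) with l by exact (eq_sym X). exact Hl.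
Qed.

(** * Mean-square convergence of the square wave *)

Definition square_wave (n : nat) (t : R) : R :=
  sum_n (fun k => sin (odd k * t) / odd k) n.

Lemma is_RInt_sin_odd_orthogonal i j : i <> j ->
  is_RInt (fun t => sin (odd i * t) * sin (odd j * t)) 0 PI 0.
Proof.
intro ij.
assert (s0 := odd_inj_sub i j ij).
assert (a0 : odd i + odd j <> 0)
  by (generalize (odd_pos i) (odd_pos j); lra).
eapply is_RInt_congr.
- apply (is_RInt_antiderivative
    (fun t => sin ((odd i - odd j) * t) / (2 * (odd i - odd j))
              - sin ((odd i + odd j) * t) / (2 * (odd i + odd j)))
    (fun t => (cos ((odd i - odd j) * t) - cos ((odd i + odd j) * t)) / 2)).
  + intro t. auto_derive; [lra | ]. field. lra.
  + intro t. auto_derive; trivial.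
- intro t. simpl.
  replace ((odd i - odd j) * t) with (odd i * t - odd j * t) by ring.
  replace ((odd i + odd j) * t) with (odd i * t + odd j * t) by ring.
  rewrite cos_plus, cos_minus. field.
- cbv beta. rewrite sin_odd_sub_PI, sin_odd_add_PI, !Rmult_0_r, sin_0.
  field. lra.
Qed.

Lemma is_RInt_sin_odd_sq i :
  is_RInt (fun t => sin (odd i * t) ^ 2) 0 PI (PI / 2).
Proof.
assert (O := odd_neq0 i).
eapply is_RInt_congr.
- apply (is_RInt_antiderivative
    (fun t => t / 2 - sin (odd i * t) * cos (odd i * t) / (2 * odd i))
    (fun t => (1 - cos (odd i * t) ^ 2 + sin (odd i * t) ^ 2) / 2)).
  + intro t. auto_derive; trivial. field. trivial.
  + intro t. auto_derive; trivial.
- intro t. simpl. generalize (sin2_cos2 (odd i * t)). unfold Rsqr. lra.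
- cbv beta. rewrite sin_odd_PI, Rmult_0_r, sin_0. field. trivial.
Qed.

Lemma is_RInt_sin_odd i :
  is_RInt (fun t => sin (odd i * t)) 0 PI (2 / odd i).
Proof.
assert (O := odd_neq0 i).
eapply is_RInt_congr.
- apply (is_RInt_antiderivative (fun t => - cos (odd i * t) / odd i)
    (fun t => sin (odd i * t))).
  + intro t. auto_derive; trivial. field. trivial.
  + intro t. auto_derive; trivial.
- reflexivity.
- cbv beta. rewrite cos_odd_PI, Rmult_0_r, cos_0. field. trivial.
Qed.

(** A partial sum is orthogonal to every sine of higher frequency, in
    particular to the next term of the series. *)
Lemma is_RInt_square_wave_sin n j : (n < j)%nat ->
  is_RInt (fun t => square_wave n t * sin (odd j * t)) 0 PI 0.
Proof.
unfold square_wave.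
induction n as [ | n IH]; intro nj.
- eapply is_RInt_congr.
  + exact (is_RInt_Rmult_l _ _ _ (/ odd 0) _
      (is_RInt_sin_odd_orthogonal 0 j ltac:(lia))).
  + intro t. cbv beta. rewrite sum_O. field. apply odd_neq0.
  + ring.
- eapply is_RInt_congr.
  + exact (is_RInt_lincomb _ _ _ _ 1 (/ odd (S n)) _ _
      (IH ltac:(lia)) (is_RInt_sin_odd_orthogonal (S n) j ltac:(lia))).
  + intro t. cbv beta. rewrite sum_Sn. unfold plus; simpl.
    field. apply odd_neq0.
  + ring.
Qed.

(** Adding the term s / N, with s = sin (N t), to the partial sum W changes
    (PI/4 - W)^2 by -(PI/2) s / N + 2 W s / N + s^2 / N^2.  The three integrals
    are -PI / N^2, 0 and (PI/2) / N^2. *)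
Lemma is_RInt_square_wave_error n :
  is_RInt (fun t => (PI / 4 - square_wave n t) ^ 2) 0 PI
    (PI / 2 * (PI ^ 2 / 8 - sum_n (fun k => / odd k ^ 2) n)).
Proof.
induction n as [ | n IH].
- assert (O := odd_neq0 0).
  eapply is_RInt_congr.
  + exact (is_RInt_lincomb _ _ _ _ 1 (/ odd 0 ^ 2) _ _
      (is_RInt_lincomb _ _ _ _ (PI ^ 2 / 16) (- (PI / 2) / odd 0) _ _
        (is_RInt_const 0 PI 1) (is_RInt_sin_odd 0))
      (is_RInt_sin_odd_sq 0)).
  + intro t. unfold square_wave. rewrite sum_O. simpl. field. trivial.
  + rewrite sum_O. unfold scal; simpl; unfold mult; simpl. field. trivial.
- assert (O := odd_neq0 (S n)).
  eapply is_RInt_congr.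
  + exact (is_RInt_lincomb _ _ _ _ 1 (/ odd (S n) ^ 2) _ _
      (is_RInt_lincomb _ _ _ _ 1 (2 / odd (S n)) _ _
        (is_RInt_lincomb _ _ _ _ 1 (- (PI / 2) / odd (S n)) _ _
          IH (is_RInt_sin_odd (S n)))
        (is_RInt_square_wave_sin n (S n) (Nat.lt_succ_diag_r n)))
      (is_RInt_sin_odd_sq (S n))).
  + intro t. unfold square_wave. rewrite sum_Sn. unfold plus; simpl.
    field. trivial.
  + rewrite sum_Sn. unfold plus; simpl. field. trivial.
Qed.

(** Mean-square convergence of the partial sums to PI / 4 passes to their
    integrals against any square-integrable f. *)
Lemma is_lim_seq_RInt_square_wave (f : R -> R) (A l : R) (u : nat -> R) :
  is_RInt (fun t => f t ^ 2) 0 PI A -> is_RInt f 0 PI l ->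
  (forall n, is_RInt (fun t => f t * square_wave n t) 0 PI (u n)) ->
  is_lim_seq u (PI / 4 * l).
Proof.
intros HA Hl Hu. apply is_lim_seq_of_sq_dist.
assert (P := PI_RGT_0).
apply is_lim_seq_le_le with (fun _ => 0)
  (fun n => A * (PI / 2 * (PI ^ 2 / 8 - sum_n (fun k => / odd k ^ 2) n))).
- intro n. split; [apply pow2_ge_0 | ].
  apply (Cauchy_Schwarz_RInt f (fun t => PI / 4 - square_wave n t) 0 PI);
    [lra | trivial | apply is_RInt_square_wave_error | ].
  eapply is_RInt_congr.
  + exact (is_RInt_lincomb _ _ _ _ (PI / 4) (-1) _ _ Hl (Hu n)).
  + intro t; simpl; ring.
  + ring.
- apply is_lim_seq_const.
- replace (Finite 0)
    with (Finite (A * (PI / 2 * (PI ^ 2 / 8 - PI ^ 2 / 8))))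
    by (f_equal; ring).
  do 2 (apply is_lim_seq_mult'; [apply is_lim_seq_const | ]).
  apply is_lim_seq_minus'; [apply is_lim_seq_const | ].
  exact is_series_inv_odd_sq.
Qed.

(** * Sine moments *)

Definition coef (k : nat) : R :=
  (-1) ^ k * (1 + delta k) * (PI ^ (2 * k) / INR (fact (2 * k))).

(** The closed form of (-1)^m int_0^PI t^(2m) / (2m)! * sin (N t) / N dt for
    N = 2n + 1; for fixed k its terms sum over n to a multiple of
    lambda(2m-2k+2). *)
Definition moment (m n : nat) : R :=
  sum_n (fun k => coef k * / odd n ^ (2 * (m - k) + 2)) m.

Lemma moment_S m n :
  moment (S m) n = moment m n / odd n ^ 2 + coef (S m) / odd n ^ 2.
Proof.
unfold moment. rewrite sum_Sn, Nat.sub_diag.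
apply (f_equal2 Rplus); [ | reflexivity].
unfold Rdiv. rewrite (Rmult_comm (sum_n _ m)).
rewrite <- sum_n_Rmult_l.
apply sum_n_ext_loc. intros k km.
replace (2 * (S m - k) + 2)%nat with (2 * (m - k) + 2 + 2)%nat by lia.
eqR.
rewrite (pow_add _ _ 2). field. split; [apply pow_nonzero | ]; apply odd_neq0.
Qed.

(** Two integrations by parts, done at once: the derivative of
    t^(2m+1) / (2m+1)! * sin (N t) / N^3 - t^(2m+2) / (2m+2)! * cos (N t) / N^2
    is the integrand for m + 1 plus 1 / N^2 times the integrand for m, because
    the two cosine terms cancel. *)
Lemma is_RInt_monomial_sin m n :
  is_RInt (fun t => t ^ (2 * m) / INR (fact (2 * m)) * (sin (odd n * t) / odd n))
    0 PI ((-1) ^ m * moment m n).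
Proof.
assert (O := odd_neq0 n).
induction m as [ | m IH].
- unfold moment, coef. rewrite sum_O. simpl.
  eapply is_RInt_congr.
  + exact (is_RInt_Rmult_l _ _ _ (/ odd n) _ (is_RInt_sin_odd n)).
  + intro t. simpl. field. trivial.
  + unfold delta; simpl. field. trivial.
- assert (F1 : INR (fact (2 * m + 1)) = (2 * INR m + 1) * INR (fact (2 * m))).
  { replace (2 * m + 1)%nat with (S (2 * m)) by lia.
    rewrite fact_simpl, mult_INR. f_equal.
    rewrite S_INR, mult_INR. simpl; ring. }
  assert (F2 : INR (fact (2 * S m))
     = (2 * INR m + 2) * ((2 * INR m + 1) * INR (fact (2 * m)))).
  { replace (2 * S m)%nat with (S (2 * m + 1)) by lia.
    rewrite fact_simpl, mult_INR, F1. f_equal.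
    rewrite S_INR, plus_INR, mult_INR. simpl; ring. }
  assert (f0 : INR (fact (2 * m)) <> 0) by apply INR_fact_neq_0.
  assert (m0 := pos_INR m).
  eapply is_RInt_congr.
  + refine (is_RInt_lincomb _ _ _ _ 1 (- / odd n ^ 2) _ _ _ IH).
    apply (is_RInt_antiderivative
      (fun t => t ^ (2 * m + 1) / INR (fact (2 * m + 1)) * sin (odd n * t)
                  / odd n ^ 3
                - t ^ (2 * m + 2) / INR (fact (2 * S m)) * cos (odd n * t)
                  / odd n ^ 2)
      (fun t => t ^ (2 * S m) / INR (fact (2 * S m)) * (sin (odd n * t) / odd n)
        + t ^ (2 * m) / INR (fact (2 * m)) * (sin (odd n * t) / odd n)
          / odd n ^ 2)).
    * intro t. rewrite F1, F2. auto_derive; trivial.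
      change (m + (m + 0))%nat with (2 * m)%nat.
      replace (pred (2 * m + 1)) with (2 * m)%nat by lia.
      replace (pred (2 * m + 2)) with (2 * m + 1)%nat by lia.
      replace (2 * S m)%nat with (2 * m + 2)%nat by lia.
      rewrite !plus_INR, !mult_INR, !pow_add. simpl INR. eqR. field.
      repeat split; trivial; lra.
    * intro t. auto_derive; trivial.
  + intro t. cbv beta. field. repeat split; trivial. apply INR_fact_neq_0.
  + cbv beta. rewrite sin_odd_PI, cos_odd_PI, moment_S.
    unfold coef, delta. simpl Nat.eqb.
    rewrite !Rmult_0_r, sin_0, cos_0.
    replace (2 * m + 2)%nat with (2 * S m)%nat by lia.
    rewrite (pow_i (2 * S m)), (pow_i (2 * m + 1)) by lia.
    replace ((-1) ^ S m) with (- (-1) ^ m) by (simpl; ring).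
    (* The sign of the last coefficient of the moment meets the same sign in
       front of the moment. *)
    transitivity (PI ^ (2 * S m) / INR (fact (2 * S m)) / odd n ^ 2
       * ((-1) ^ m * (-1) ^ m) - (-1) ^ m * moment m n / odd n ^ 2).
    * rewrite sign_mul_sign. field. repeat split; trivial; apply INR_fact_neq_0.
    * field. repeat split; trivial; apply INR_fact_neq_0.
Qed.

Lemma is_RInt_monomial_square_wave m n :
  is_RInt (fun t => t ^ (2 * m) / INR (fact (2 * m)) * square_wave n t) 0 PI
    (sum_n (fun k => (-1) ^ m * moment m k) n).
Proof.
unfold square_wave.
induction n as [ | n IH].
- rewrite sum_O. eapply is_RInt_congr; [apply (is_RInt_monomial_sin m 0) | | ].
  + intro t. now rewrite sum_O.
  + reflexivity.
- eapply is_RInt_congr.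
  + exact (is_RInt_lincomb _ _ _ _ 1 1 _ _ IH (is_RInt_monomial_sin m (S n))).
  + intro t. cbv beta. rewrite sum_Sn. unfold plus; simpl. eqR; ring.
  + rewrite sum_Sn. unfold plus; simpl. eqR; ring.
Qed.

Lemma is_RInt_pow (d : nat) (b : R) :
  is_RInt (fun t => t ^ d) 0 b (b ^ S d / INR (S d)).
Proof.
assert (d0 : INR (S d) <> 0) by (apply not_0_INR; lia).
eapply is_RInt_congr.
- apply (is_RInt_antiderivative (fun t => t ^ S d / INR (S d))
    (fun t => t ^ d)).
  + intro t. auto_derive; trivial. simpl pred. field. trivial.
  + intro t. auto_derive; trivial.
- reflexivity.
- cbv beta. rewrite (pow_i (S d)) by lia. field. trivial.
Qed.

(** The sum over n of the integrals of [is_RInt_monomial_sin] is PI / 4 times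
    the integral of t^(2m) / (2m)!. *)
Lemma is_series_moment m :
  is_series (moment m)
    ((-1) ^ m * (PI ^ (2 * m + 2) / (4 * INR (fact (2 * m + 1))))).
Proof.
assert (f0 : INR (fact (2 * m)) <> 0) by apply INR_fact_neq_0.
assert (S0 : INR (S (2 * m)) <> 0) by (apply not_0_INR; lia).
apply is_series_ext with (fun n => scal ((-1) ^ m) ((-1) ^ m * moment m n)).
{ intro n. unfold scal; simpl; unfold mult; simpl.
  rewrite <- Rmult_assoc, sign_mul_sign. ring. }
apply (is_series_scal (V := R_NormedModule) ((-1) ^ m)).
replace (PI ^ (2 * m + 2) / (4 * INR (fact (2 * m + 1))))
  with (PI / 4 * (/ INR (fact (2 * m)) * (PI ^ S (2 * m) / INR (S (2 * m))))).
2: { replace (2 * m + 2)%nat with (S (S (2 * m))) by lia.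
     replace (2 * m + 1)%nat with (S (2 * m)) by lia.
     rewrite fact_simpl, mult_INR, <- (tech_pow_Rmult PI (S (2 * m))).
     field. split; trivial. }
apply (is_lim_seq_RInt_square_wave
         (fun t => t ^ (2 * m) / INR (fact (2 * m)))
         (/ INR (fact (2 * m)) ^ 2 * (PI ^ S (2 * m * 2) / INR (S (2 * m * 2))))).
- eapply is_RInt_congr.
  + exact (is_RInt_Rmult_l _ _ _ (/ INR (fact (2 * m)) ^ 2) _
      (is_RInt_pow (2 * m * 2) PI)).
  + intro t. cbv beta. rewrite (pow_mult t (2 * m) 2). field. trivial.
  + reflexivity.
- eapply is_RInt_congr.
  + exact (is_RInt_Rmult_l _ _ _ (/ INR (fact (2 * m))) _
      (is_RInt_pow (2 * m) PI)).
  + intro t. cbv beta. field. trivial.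
  + reflexivity.
- intro n. apply is_RInt_monomial_square_wave.
Qed.

(** * The lambda function at even integers *)

Lemma ex_series_inv_odd_pow j : ex_series (fun n => / odd n ^ (2 * j + 2)).
Proof.
apply (ex_series_le (V := R_CompleteNormedModule) _ (fun n => / odd n ^ 2)).
- intro n. assert (O := odd_pos n).
  unfold norm; simpl norm. unfold abs; simpl abs. rewrite Rabs_right.
  + apply Rinv_le_contravar; [apply pow_lt, O | ].
    apply Rle_pow; [ | lia]. rewrite oddE. generalize (pos_INR n); lra.
  + apply Rle_ge, Rlt_le, Rinv_0_lt_compat, pow_lt, O.
- exists (PI ^ 2 / 8). exact is_series_inv_odd_sq.
Qed.

Lemma Rpow_C_INR (x : R) (d : nat) : 0 < x -> Rpow_C x (RtoC (INR d)) = RtoC (x ^ d).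
Proof.
intro x0. unfold Rpow_C. rewrite <- RtoC_mult. unfold Cexp, RtoC; simpl.
rewrite sin_0, cos_0, Rmult_0_r, Rmult_1_r.
now rewrite <- (Rpower_pow d x x0).
Qed.

Lemma dirichlet_lambda_even j :
  dirichlet_lambda (RtoC (INR (2 * j + 2)))
  = RtoC (Series (fun n => / odd n ^ (2 * j + 2))).
Proof.
unfold dirichlet_lambda, CSeries.
assert (E : forall n,
  (1 / Rpow_C (INR (2 * n + 1)) (RtoC (INR (2 * j + 2))))%C
  = RtoC (/ odd n ^ (2 * j + 2))).
{ intro n. fold (odd n). rewrite Rpow_C_INR by apply odd_pos.
  assert (odd n ^ (2 * j + 2) <> 0) by (apply pow_nonzero, odd_neq0).
  rewrite <- RtoC_div by trivial. f_equal. field. trivial. }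
unfold RtoC at 5. f_equal.
- apply Series_ext. intro n. now rewrite E.
- rewrite (Series_ext _ (fun _ => 0 * 0)).
  + rewrite Series_scal_l. ring.
  + intro n. rewrite E. simpl. ring.
Qed.

Lemma sum_n_RtoC (a : nat -> R) n :
  sum_n (fun k => RtoC (a k)) n = RtoC (sum_n a n).
Proof.
induction n as [ | n IH].
- now rewrite !sum_O.
- rewrite !sum_Sn, IH. unfold plus; simpl. now rewrite RtoC_plus.
Qed.

Theorem corollary1p4 (m : nat) :
  (RtoC ((-1) ^ (m + 1) * (PI ^ (2 * m + 2) / (4 * INR (fact (2 * m + 1)))))
   + sum_n (fun k : nat =>
       RtoC ((-1) ^ k * (1 + delta k) * (PI ^ (2 * k) / INR (fact (2 * k))))
       * dirichlet_lambda (RtoC (2 * INR m - 2 * INR k + 2))) m)%C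
  = RtoC 0.
Proof.
set (lam := fun j => Series (fun n => / odd n ^ (2 * j + 2))).
rewrite (sum_n_ext_loc _ (fun k => RtoC (coef k * lam (m - k)%nat))).
2: { intros k km.
     replace (2 * INR m - 2 * INR k + 2) with (INR (2 * (m - k) + 2))
       by (rewrite plus_INR, mult_INR, minus_INR by trivial; simpl; ring).
     rewrite dirichlet_lambda_even. symmetry. apply RtoC_mult. }
rewrite sum_n_RtoC, <- RtoC_plus. f_equal.
assert (H : is_series (moment m) (sum_n (fun k => coef k * lam (m - k)%nat) m)).
{ apply (is_series_sum_n (fun k n => coef k * / odd n ^ (2 * (m - k) + 2))).
  intros k _.
  apply (is_series_scal (V := R_NormedModule) (coef k)).
  apply Series_correct, ex_series_inv_odd_pow. }
rewrite <- (is_series_unique _ _ H), (is_series_unique _ _ (is_series_moment m)).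
rewrite pow_add. field. apply INR_fact_neq_0.
Qed.
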